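(* Let $j\in\{1,2,3,4\}$, $\lambda\in\{1,-1\}$. The canal hypersurface in $E_1^4$ $$\mathfrak{C}^{\{j;\lambda\}}(s,t,w)=\beta-\lambda\varepsilon_1 rr'F_1+ r\sqrt{r'^2-\lambda\varepsilon_1}\,\sum_{i=2}^{4}\mathfrak{a}_iF_i,\qquad r'(s)^2>\lambda\varepsilon_1 ,$$ is $(H,K)_{tw}$-Weingarten, i.e. its mean curvature $H$ and Gaussian curvature $K$ satisfy $H_tK_w-H_wK_t=0$.
   Context: $E_1^4$ is $\mathbb{R}^4$ with the inner product $g(x,y)=\langle x,y\rangle=-x_1y_1+x_2y_2+x_3y_3+x_4y_4$. $\beta:I\to E_1^4$ ($I$ an open interval) is a smooth unit-speed curve with smooth Frenet frame $F_1=\beta',F_2,F_3,F_4$, pairwise orthogonal, $g(F_i,F_i)=\varepsilon_i$, where $\varepsilon_j=-1$ and $\varepsilon_i=1$ for $i\neq j$. The Frenet equations are $$F_1'=k_1F_2,\quad F_2'=\varepsilon_3\varepsilon_4k_1F_1+k_2F_3,\quad F_3'=\varepsilon_1\varepsilon_4k_2F_2+k_3F_4,\quad F_4'=\varepsilon_1\varepsilon_2k_3F_3,$$ with smooth functions $k_1,k_2,k_3$ on $I$. The radius function $r:I\to(0,\infty)$ is smooth. The functions $\mathfrak{a}_i(t,w)$ are: for $j=1$: $\mathfrak{a}_2=\cos t\cos w$, $\mathfrak{a}_3=\sin t\cos w$, $\mathfrak{a}_4=\sin w$; for $j=2$: $\mathfrak{a}_2=\cosh t\cosh w$, $\mathfrak{a}_3=\sinh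 w$, $\mathfrak{a}_4=\sinh t\cosh w$; for $j=3$: $\mathfrak{a}_2=\sinh t\cosh w$, $\mathfrak{a}_3=\cosh t\cosh w$, $\mathfrak{a}_4=\sinh w$; for $j=4$: $\mathfrak{a}_2=\sinh w$, $\mathfrak{a}_3=\sinh t\cosh w$, $\mathfrak{a}_4=\cosh t\cosh w$. For a parametrized hypersurface $\Gamma(u_1,u_2,u_3)$ with smooth unit normal field $N$: $g_{ik}=\langle\Gamma_{u_i},\Gamma_{u_k}\rangle$, $h_{ik}=\langle\Gamma_{u_iu_k},N\rangle$, $S=[g_{ik}]^{-1}[h_{ik}]$, $\varepsilon=\langle N,N\rangle$, $K=\varepsilon\det[h_{ik}]/\det[g_{ik}]$, and $H$ is defined by $3\varepsilon H=\operatorname{tr}(S)$. Here $(u_1,u_2,u_3)=(s,t,w)$; everything is considered at regular points (where $\det[g_{ik}]\neq0$). Subscripts $t,w$ on $H,K$ denote partial derivatives. *)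

(* Defs.v *)
From HB Require Import structures.
From mathcomp Require Import all_boot all_order all_algebra.
From mathcomp Require Import all_classical all_reals all_analysis.

Set Implicit Arguments.
Unset Strict Implicit.
Unset Printing Implicit Defensive.

Import Order.TTheory GRing.Theory Num.Theory.
Import numFieldNormedType.Exports.

Local Open Scope ring_scope.
Local Open Scope classical_set_scope.

(* Index convention: all indices are shifted by one, i.e. the coordinates
   x_1, ..., x_4, the frame F_1, ..., F_4, the signs eps_1, ..., eps_4 and the
   causal type j = 1, ..., 4 are indexed by 0, ..., 3 : 'I_4.  The parameters
   (s, t, w) of a hypersurface are the coordinates 0, 1, 2 of a row vector. *)

Section Smoothness.
Context {R : realType} {V W : normedModType R}.

(* For V finite dimensional and A open this is C^oo-smoothness of f on A. *)
Definition smooth_on (A : set V) (f : V -> W) : Prop :=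
  forall (vs : seq V) (x : V), A x ->
    differentiable (foldr (fun v g => 'D_v g) f vs) x.

End Smoothness.

Section Hyperbolic.
Context {R : realType}.

Definition cosh (x : R) : R := (expR x + expR (- x)) / 2.
Definition sinh (x : R) : R := (expR x - expR (- x)) / 2.

End Hyperbolic.

Section Minkowski.
Context {R : realType}.

Definition lorentz (x y : 'rV[R]_4) : R :=
  - (x 0 0 * y 0 0) + \sum_(i < 4 | i != 0) x 0 i * y 0 i.

Definition eps (j i : 'I_4) : R := if i == j then -1 else 1.

(* F_1, ..., F_4 is a Frenet frame with curvatures k1, k2, k3 along the
   unit-speed curve beta on I, the vector F_j being the timelike one. *)
Record frenet_curve (j : 'I_4) (I : set R) (beta : R -> 'rV[R]_4)
    (F : 'I_4 -> R -> 'rV[R]_4) (k1 k2 k3 : R -> R) : Prop := FrenetCurve {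
  frenet_smooth_curve : smooth_on I beta;
  frenet_smooth_frame : forall i, smooth_on I (F i);
  frenet_smooth_k1 : smooth_on I k1;
  frenet_smooth_k2 : smooth_on I k2;
  frenet_smooth_k3 : smooth_on I k3;
  frenet_tangent : forall s, I s -> F 0 s = beta^`() s;
  frenet_norm : forall s i, I s -> lorentz (F i s) (F i s) = eps j i;
  frenet_orthogonal : forall s i l, I s -> i != l ->
    lorentz (F i s) (F l s) = 0;
  frenet_eq1 : forall s, I s ->
    (F 0)^`() s = k1 s *: F 1 s;
  frenet_eq2 : forall s, I s ->
    (F 1)^`() s = (eps j 2 * eps j 3 * k1 s) *: F 0 s + k2 s *: F 2 s;
  frenet_eq3 : forall s, I s ->
    (F 2)^`() s = (eps j 0 * eps j 3 * k2 s) *: F 1 s + k3 s *: F 3 s;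
  frenet_eq4 : forall s, I s ->
    (F 3)^`() s = (eps j 0 * eps j 1 * k3 s) *: F 2 s }.

(* The value at i = 0 (no such coefficient exists) is never used. *)
Definition canal_coef (j i : 'I_4) (t w : R) : R :=
  match val j, val i with
  | 0%N, 1%N => cos t * cos w
  | 0%N, 2%N => sin t * cos w
  | 0%N, 3%N => sin w
  | 1%N, 1%N => cosh t * cosh w
  | 1%N, 2%N => sinh w
  | 1%N, 3%N => sinh t * cosh w
  | 2%N, 1%N => sinh t * cosh w
  | 2%N, 2%N => cosh t * cosh w
  | 2%N, 3%N => sinh w
  | 3%N, 1%N => sinh w
  | 3%N, 2%N => sinh t * cosh w
  | 3%N, 3%N => cosh t * cosh w
  | _, _ => 0
  end.

Definition canal (j : 'I_4) (lambda : R) (beta : R -> 'rV[R]_4)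
    (F : 'I_4 -> R -> 'rV[R]_4) (r : R -> R) (u : 'rV[R]_3) : 'rV[R]_4 :=
  let s := u 0 0 in let t := u 0 1 in let w := u 0 2 in
  beta s - (lambda * eps j 0 * r s * derive1 r s) *: F 0 s
  + (r s * Num.sqrt ((derive1 r s) ^+ 2 - lambda * eps j 0))
      *: \sum_(i < 4 | i != 0) canal_coef j i t w *: F i s.

End Minkowski.

Section Hypersurface.
Context {R : realType}.
Implicit Types (Gamma N : 'rV[R]_3 -> 'rV[R]_4) (u : 'rV[R]_3).

Definition pderiv (W : normedModType R) (i : 'I_3) (f : 'rV[R]_3 -> W) :
  'rV[R]_3 -> W := 'D_(delta_mx 0 i) f.

Definition first_form Gamma u : 'M[R]_3 :=
  \matrix_(i, k) lorentz (pderiv i Gamma u) (pderiv k Gamma u).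

Definition second_form Gamma N u : 'M[R]_3 :=
  \matrix_(i, k) lorentz (pderiv k (pderiv i Gamma) u) (N u).

Definition shape_operator Gamma N u : 'M[R]_3 :=
  invmx (first_form Gamma u) *m second_form Gamma N u.

Definition normal_sign N u : R := lorentz (N u) (N u).

(* Solution of 3 * normal_sign * H = \tr S; the sign is nonzero for a unit N. *)
Definition mean_curvature Gamma N u : R :=
  \tr (shape_operator Gamma N u) / (3 * normal_sign N u).

Definition gauss_curvature Gamma N u : R :=
  normal_sign N u * \det (second_form Gamma N u) / \det (first_form Gamma u).

Definition unit_normal_field (U : set 'rV[R]_3) Gamma N : Prop :=
  [/\ smooth_on U N,
      forall u i, U u -> lorentz (pderiv i Gamma u) (N u) = 0 &
      forall u, U u -> `|lorentz (N u) (N u)| = 1].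

Definition HK_tw_Weingarten (U : set 'rV[R]_3) Gamma N : Prop :=
  forall u, U u ->
    let H := mean_curvature Gamma N in let K := gauss_curvature Gamma N in
    pderiv 1 H u * pderiv 2 K u - pderiv 2 H u * pderiv 1 K u = 0.

End Hypersurface.

(* Main.v *)
Require Import Defs.
From mathcomp Require Import all_boot all_order all_algebra.
From mathcomp Require Import all_classical all_reals all_analysis.
From mathcomp Require Import ring lra.
Import Order.TTheory GRing.Theory Num.Theory.
Import numFieldNormedType.Exports.
Local Open Scope ring_scope.
Local Open Scope classical_set_scope.

(** A canal hypersurface is the envelope of the pseudo-spheres of radius
    [r s] centered at [beta s]. With [P = Gamma - beta] one has
    [<P, P> = lambda * r ^+ 2], and [P] is orthogonal to the hypersurface
    ([canal_radial_norm] and [canal_radial_tangent]). At a regular point the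
    orthogonal complement of the tangent space is a line, so any unit normal
    is [N = kappa *: P] with [kappa ^+ 2 * r ^+ 2 = 1]
    ([lorentz_complement]).

    Along a parameter line of [t] or [w] the numbers [s], [r s] and [beta s]
    are constant; so is [kappa], which is continuous with values in
    [{1 / r, - 1 / r}]. Hence [N_t = kappa *: Gamma_t] and
    [N_w = kappa *: Gamma_w], and differentiating [<Gamma_i, N> = 0] gives
    [h_ik = - kappa * g_ik] for [k = t, w]: the last two columns of the shape
    operator [S] are those of the scalar matrix [- kappa]. So two principal
    curvatures equal [- kappa], the determinant and the trace of [S] determine
    each other affinely, and
    [K = 3 * kappa ^+ 2 * H + 2 * lambda * kappa ^+ 3]
    ([gauss_mean_relation]). The coefficients of this relation do not vary with
    [t] and [w], so [(K_t, K_w)] is a multiple of [(H_t, H_w)] and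
    [H_t K_w - H_w K_t = 0] ([HK_tw_Weingarten_envelope]).

    The regularity behind these differentiations comes from the special form
    of the parametrization, a sum of products of a function of [t], a function
    of [w] and a vector function of [s] ([separated_map]). *)

Set Implicit Arguments.
Unset Strict Implicit.

(** * The Lorentzian inner product *)

Lemma lorentzE (R : realType) (x y : 'rV[R]_4) :
  lorentz x y = \sum_(i < 4) eps 0 i * x 0 i * y 0 i.
Proof.
rewrite /lorentz [RHS](bigD1 0) //=; congr (_ + _).
  by rewrite /eps eqxx; ring.
by apply: eq_bigr => i /negPf i0; rewrite /eps i0 mul1r.
Qed.

Lemma lorentzC (R : realType) (x y : 'rV[R]_4) : lorentz x y = lorentz y x.
Proof. by rewrite !lorentzE; apply: eq_bigr => i _; rewrite mulrAC. Qed.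

Lemma lorentzDl (R : realType) (x y z : 'rV[R]_4) :
  lorentz (x + y) z = lorentz x z + lorentz y z.
Proof.
rewrite !lorentzE -big_split; apply: eq_bigr => i _ /=.
by rewrite mxE mulrDr mulrDl.
Qed.

Lemma lorentzZl (R : realType) (a : R) (x y : 'rV[R]_4) :
  lorentz (a *: x) y = a * lorentz x y.
Proof.
rewrite !lorentzE big_distrr; apply: eq_bigr => i _ /=.
by rewrite mxE mulrCA !mulrA.
Qed.

Lemma lorentzZr (R : realType) (a : R) (x y : 'rV[R]_4) :
  lorentz x (a *: y) = a * lorentz x y.
Proof. by rewrite lorentzC lorentzZl lorentzC. Qed.

Lemma lorentzBr (R : realType) (x y z : 'rV[R]_4) :
  lorentz x (y - z) = lorentz x y - lorentz x z.
Proof. by rewrite !(lorentzC x) lorentzDl -scaleN1r lorentzZl mulN1r. Qed.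

Lemma lorentz_suml (R : realType) (n : nat) (x : 'I_n -> 'rV[R]_4) (z : 'rV[R]_4) :
  lorentz (\sum_(i < n) x i) z = \sum_(i < n) lorentz (x i) z.
Proof.
apply: (big_morph (lorentz ^~ z)) => [x1 x2|].
  exact: lorentzDl.
by rewrite -(scale0r (0 : 'rV[R]_4)) lorentzZl mul0r.
Qed.

Lemma lorentz_frame_coord (R : realType) (e : 'I_4 -> R)
    (E : 'I_4 -> 'rV[R]_4) (a : 'I_4 -> R) (l : 'I_4)
    (hnorm : forall i, lorentz (E i) (E i) = e i)
    (horth : forall i k, i != k -> lorentz (E i) (E k) = 0) :
  lorentz (\sum_(i < 4) a i *: E i) (E l) = a l * e l.
Proof.
rewrite lorentz_suml (bigD1 l) //= big1 => [|i il].
  by rewrite lorentzZl hnorm addr0.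
by rewrite lorentzZl horth // mulr0.
Qed.

Lemma lorentz_frame (R : realType) (e : 'I_4 -> R) (E : 'I_4 -> 'rV[R]_4)
    (a : 'I_4 -> R)
    (hnorm : forall i, lorentz (E i) (E i) = e i)
    (horth : forall i k, i != k -> lorentz (E i) (E k) = 0) :
  lorentz (\sum_(i < 4) a i *: E i) (\sum_(i < 4) a i *: E i)
  = \sum_(i < 4) a i ^+ 2 * e i.
Proof.
rewrite {1}lorentz_suml; apply: eq_bigr => i _.
by rewrite lorentzZl lorentzC (lorentz_frame_coord _ _ hnorm horth) mulrA -expr2.
Qed.

(** The Gram matrix of [E 0, E 1, E 2, p] is block diagonal with invertible
    blocks, so these four vectors form a basis. The difference of the two sides
    is orthogonal to all of them, and the form is nondegenerate. *)
Lemma lorentz_complement (R : realType) (E : 'I_3 -> 'rV[R]_4) (p n : 'rV[R]_4)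
    (hgram : \det (\matrix_(i, k) lorentz (E i) (E k)) != 0)
    (hp : lorentz p p != 0)
    (hEp : forall i, lorentz (E i) p = 0)
    (hEn : forall i, lorentz (E i) n = 0) :
  n = (lorentz p n / lorentz p p) *: p.
Proof.
pose J : 'M[R]_4 := diag_mx (\row_i eps 0 i).
have formE (x y : 'rV[R]_4) : (x *m J *m y^T) 0 0 = lorentz x y.
  rewrite lorentzE mxE; apply: eq_bigr => i _.
  by rewrite mul_mx_diag !mxE; ring.
pose M : 'M[R]_(3 + 1, 4) := col_mx (\matrix_i E i) p.
have rowM i (x : 'rV[R]_4) : (M *m J *m x^T) i 0 =
    lorentz (row i M) x.
  by rewrite -formE -[in RHS]row_mul -row_mul [in RHS]mxE.
pose G : 'M[R]_3 := \matrix_(i, k) lorentz (E i) (E k).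
have gramM : M *m J *m M^T = block_mx G 0 0 (lorentz p p)%:M.
  apply/matrixP => i k.
  have -> : (M *m J *m M^T) i k = lorentz (row i M) (row k M).
    rewrite -rowM tr_row [in RHS]mxE [LHS]mxE.
    by apply: eq_bigr => l _; rewrite !mxE.
  case: (split_ordP i) => i' ->; case: (split_ordP k) => k' ->.
  - by rewrite /M !rowKu !rowK block_mxEul !mxE.
  - by rewrite /M rowKu rowKd rowK !ord1 row_id block_mxEur mxE hEp.
  - by rewrite /M rowKu rowKd rowK !ord1 row_id block_mxEdl mxE lorentzC hEp.
  - by rewrite /M !rowKd !ord1 row_id block_mxEdr mxE eqxx mulr1n.
have MJ_unit : M *m J \in unitmx.
  have : \det (M *m J *m M^T) != 0.
    by rewrite gramM (det_ublock G 0 _) det_scalar1 mulf_neq0.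
  by rewrite unitmxE unitfE det_mulmx mulf_eq0 negb_or => /andP[].
set q := _ *: p; suff : n - q = 0 by move=> /eqP; rewrite subr_eq0 => /eqP.
apply: trmx_inj; rewrite trmx0 -[LHS](mulKmx MJ_unit).
suff -> : M *m J *m (n - q)^T = 0 by rewrite mulmx0.
apply/matrixP => i z; rewrite (ord1 z) rowM [RHS]mxE lorentzBr lorentzZr.
case: (split_ordP i) => i' ->.
  by rewrite /M rowKu rowK hEp hEn mulr0 subr0.
by rewrite /M rowKd ord1 row_id divfK // subrr.
Qed.

(** * Shape operators with a double principal curvature *)

(** Such a matrix is triangular with diagonal [\tr A - 2 c, c, c]. *)
Lemma det_last_columns_scalar (R : comNzRingType) (A : 'M[R]_3) (c : R)
    (hA : forall i k, k != 0 -> A i k = c *+ (i == k)) :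
  \det A = c ^+ 2 * (\tr A - 2 * c).
Proof.
have trigA : is_trig_mx A.
  apply/is_trig_mxP => i k ik; rewrite hA; last first.
    by apply: contraL ik => /eqP ->.
  by rewrite (_ : i == k = false) //; apply/eqP => eik; rewrite eik ltnn in ik.
rewrite det_trig // /mxtrace !big_ord_recl !big_ord0.
by rewrite !(hA (lift _ _) (lift _ _)) // !eqxx !mulr1n; ring.
Qed.

(** The hypothesis says that [S] agrees with [- kappa] outside its first column,
    that is, that [- kappa] is a double principal curvature. The trace of [S]
    then gives the third one, and with it the determinant. *)
Lemma gauss_mean_relation (R : realType) (Gamma N : 'rV[R]_3 -> 'rV[R]_4)
    (u : 'rV[R]_3) (kappa : R)
    (hreg : \det (first_form Gamma u) != 0)
    (hsign : normal_sign N u ^+ 2 = 1)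
    (hshape : forall i k, k != 0 ->
       second_form Gamma N u i k = - kappa * first_form Gamma u i k) :
  gauss_curvature Gamma N u = 3 * kappa ^+ 2 * mean_curvature Gamma N u
                              + 2 * normal_sign N u * kappa ^+ 3.
Proof.
have sign0 : normal_sign N u != 0.
  by apply/eqP => e0; move: hsign; rewrite e0 expr0n => /eqP; rewrite eq_sym oner_eq0.
have g_unit : first_form Gamma u \in unitmx by rewrite unitmxE unitfE.
have detS : gauss_curvature Gamma N u =
    normal_sign N u * \det (shape_operator Gamma N u).
  by rewrite /gauss_curvature /shape_operator det_mulmx det_inv mulrAC mulrA.
have trS : \tr (shape_operator Gamma N u) =
    3 * normal_sign N u * mean_curvature Gamma N u.
  by rewrite /mean_curvature mulrC divfK // mulf_neq0 // pnatr_eq0.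
rewrite detS (@det_last_columns_scalar _ _ (- kappa)) => [|i k k0]; last first.
  rewrite /shape_operator mxE.
  under eq_bigr => l _ do rewrite hshape // mulrCA.
  rewrite -big_distrr /=.
  have := congr1 (fun A : 'M[R]_3 => A i k) (mulVmx g_unit).
  by rewrite !mxE => ->; rewrite mulr_natr.
transitivity (normal_sign N u ^+ 2 * (3 * kappa ^+ 2 * mean_curvature Gamma N u)
              + 2 * normal_sign N u * kappa ^+ 3).
  by rewrite trS; ring.
by rewrite hsign mul1r.
Qed.

(** * Directional derivatives *)

Lemma is_derive_coordP (R : realFieldType) (V : normedModType R) (m n : nat)
    (M : V -> 'M[R]_(m, n)) (x v : V) (dM : 'M[R]_(m, n)) :
  is_derive x v M dM <->
  forall i k, is_derive x v (fun y => M y i k) (dM i k).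
Proof.
split=> [[exM <-] i k|hM].
  apply: DeriveDef; first by move/derivable_mxP : exM.
  by rewrite derive_mx // mxE.
have exM : derivable M x v by apply/derivable_mxP => i k; exact: ex_derive.
apply: DeriveDef => //; rewrite derive_mx //; apply/matrixP => i k.
by rewrite mxE derive_val.
Qed.

Lemma is_derive_scale (R : realFieldType) (V : normedModType R) (n : nat)
    (a : V -> R) (M : V -> 'rV[R]_n) (x v : V) (da : R) (dM : 'rV[R]_n)
    (ha : is_derive x v a da) (hM : is_derive x v M dM) :
  is_derive x v (fun y => a y *: M y) (da *: M x + a x *: dM).
Proof.
apply/is_derive_coordP => i k.
have hMik := (is_derive_coordP M x v dM).1 hM i k.
rewrite (_ : (fun y => _) = a * (fun y => M y i k)); last first.
  by apply/funext => y; rewrite !mxE.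
apply: (is_derive_eq (is_deriveM ha hMik)).
by rewrite !mxE addrC [X in _ + X]mulrC.
Qed.

Lemma is_derive_lorentz (R : realType) (V : normedModType R)
    (P Q : V -> 'rV[R]_4) (x v : V) (dP dQ : 'rV[R]_4)
    (hP : is_derive x v P dP) (hQ : is_derive x v Q dQ) :
  is_derive x v (fun y => lorentz (P y) (Q y))
    (lorentz dP (Q x) + lorentz (P x) dQ).
Proof.
rewrite (_ : (fun y => _) =
    \sum_(i < 4) eps 0 i \*: ((fun y => P y 0 i) * (fun y => Q y 0 i)));
  last first.
  apply/funext => y; rewrite lorentzE fct_sumE.
  by apply: eq_bigr => i _; rewrite -mulrA.
have hi i := is_deriveM ((is_derive_coordP P x v dP).1 hP 0 i)
                        ((is_derive_coordP Q x v dQ).1 hQ 0 i).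
apply: (is_derive_eq (is_derive_sum (fun i => is_deriveZ (eps 0 i) (hi i)))).
rewrite !lorentzE -big_split; apply: eq_bigr => i _ /=.
by rewrite /GRing.scale /=; ring.
Qed.

Lemma is_derive_coord_comp (R : realType) (W : normedModType R) (n : nat)
    (A : R -> W) (i : 'I_n) (u v : 'rV[R]_n)
    (hA : derivable A (u 0 i) 1) :
  is_derive u v (fun y => A (y 0 i)) (v 0 i *: derive1 A (u 0 i)).
Proof.
have dA : differentiable A (u 0 i) by apply/derivable1_diffP.
have dc : differentiable (fun y : 'rV[R]_n => y 0 i) u
  by exact: differentiable_coord.
have dAc := differentiable_comp dc dA.
apply: DeriveDef; first exact: diff_derivable.
have [_ <-] : is_derive u v (fun y : 'rV[R]_n => y 0 i) (v 0 i).
  exact: (is_derive_coordP id u v v).1 (is_derive_id u v) 0 i.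
by rewrite !deriveE // (diff_comp dc dA) /= diff1E.
Qed.

(** A directional derivative only sees the values on the line through [u] in
    the direction [v]. Functions of [s] can thus be treated as constants when
    differentiating in [t] or [w]. *)
Lemma derive_lineE (R : realType) (V W : normedModType R) (f : V -> W)
    (u v : V) :
  'D_v f u = 'D_1 (fun h : R => f (h *: v + u)) 0.
Proof.
rewrite /derive; set q1 := fun h => h^-1 *: _; set q2 := fun h => h^-1 *: _.
suff -> : q1 = q2 by [].
apply/funext => h; rewrite /q1 /q2 /=.
by rewrite addr0 scale0r add0r [_%:A]mulr1.
Qed.

Lemma derive_eq_line (R : realType) (V W : normedModType R) (f g : V -> W)
    (u v : V)
    (hfg : \forall h \near (0 : R), f (h *: v + u) = g (h *: v + u)) :
  'D_v f u = 'D_v g u.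
Proof.
by rewrite (derive_lineE f) (derive_lineE g); apply: (@near_eq_derive _ _ _ _ _ 0 (1 : R)).
Qed.

Lemma is_derive_eq_line (R : realType) (V W : normedModType R) (f g : V -> W)
    (u v : V) (df : W)
    (hfg : \forall h \near (0 : R), f (h *: v + u) = g (h *: v + u))
    (hf : is_derive u v f df) :
  is_derive u v g df.
Proof.
case: hf => exf dff; apply: DeriveDef; last by rewrite -(derive_eq_line hfg).
apply/(derivable1P g u v).
apply: (@near_eq_derivable _ _ _ (fun h : R => f (h *: v + u))) => //.
exact/(derivable1P f u v).
Qed.

(** When [f] has no derivative along [v], neither has [a * f + b], and both
    sides are the default value 0 of a divergent limit. *)
Lemma derive_affine (R : realType) (V : normedModType R) (f : V -> R)
    (a b : R) (u v : V) (ha : a != 0) :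
  'D_v (fun y => a * f y + b) u = a * 'D_v f u.
Proof.
have [exf|nexf] := pselect (derivable f u v).
  have hf := derivableP exf.
  have := is_deriveD (is_deriveZ a hf) (is_derive_cst b u v).
  by case=> _; rewrite addr0.
have nexaf : ~ derivable (fun y => a * f y + b) u v.
  move=> exaf; apply: nexf.
  have := derivableZ (k := a^-1) (derivableB exaf (derivable_cst b u v)).
  congr (derivable _ u v); apply/funext => y.
  transitivity (a^-1 * (a * f y + b - b)) => //.
  by rewrite addrK mulKf.
by rewrite /derive (dvgP nexf) (dvgP nexaf) [RHS]mulr0.
Qed.

(** Near [F] the values are [l] or [- l], and the second one is excluded since
    [phi + l] tends to [l + l], which is nonzero. *)
Lemma near_const_of_sqr (R : realType) (T : Type) (F : set_system T)
    (phi : T -> R) (l : R) {FF : Filter F} (hl : l != 0)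
    (hcvg : phi @ F --> l)
    (hsqr : \forall h \near F, phi h ^+ 2 = l ^+ 2) :
  \forall h \near F, phi h = l.
Proof.
have : \forall h \near F, phi h + l != 0.
  have hcvg2 : (fun h => phi h + l) @ F --> l + l.
    by apply: cvgD => //; exact: cvg_cst.
  have /cvgr_neq0 := hcvg2; apply.
  by rewrite -mulr2n mulrn_eq0.
apply: filterS2 hsqr => h /eqP hh hn.
by move: hh; rewrite -subr_eq0 subr_sqr mulf_eq0 (negPf hn) orbF subr_eq0 => /eqP.
Qed.

Lemma near_line (R : realType) (V : normedModType R) (U : set V) (u v : V)
    (hU : open U) (hu : U u) :
  \forall h \near (0 : R), U (h *: v + u).
Proof.
have hc : (fun h : R => h *: v + u) @ (0 : R) --> (0 *: v + u : V).
  by apply: cvgD; [exact: cvgZr_tmp|exact: cvg_cst].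
rewrite scale0r add0r in hc.
exact: (hc _ (open_nbhs_nbhs (conj hU hu))).
Qed.

(** * Envelopes of pseudo-spheres *)

(** The argument for a hypersurface whose position relative to the center
    [c s] is normal and has square [lambda * r s ^+ 2]. *)
Lemma HK_tw_Weingarten_envelope (R : realType) (U : set 'rV[R]_3)
    (Gamma N : 'rV[R]_3 -> 'rV[R]_4) (c : R -> 'rV[R]_4) (r : R -> R)
    (lambda : R)
    (hUopen : open U)
    (hlambda : lambda ^+ 2 = 1)
    (hr : forall u, U u -> r (u 0 0) != 0)
    (hnorm : forall u, U u ->
       lorentz (Gamma u - c (u 0 0)) (Gamma u - c (u 0 0))
       = lambda * r (u 0 0) ^+ 2)
    (hperp : forall u i, U u ->
       lorentz (pderiv i Gamma u) (Gamma u - c (u 0 0)) = 0)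
    (hderiv : forall u k, U u -> derivable Gamma u (delta_mx 0 k))
    (hderiv2 : forall u i k, U u -> k != 0 ->
       derivable (pderiv i Gamma) u (delta_mx 0 k))
    (hreg : forall u, U u -> \det (first_form Gamma u) != 0)
    (hN : unit_normal_field U Gamma N) :
  HK_tw_Weingarten U Gamma N.
Proof.
case: hN => Nsmooth Nperp Nunit.
pose P u := Gamma u - c (u 0 0).
pose phi u := lorentz (P u) (N u).
pose kappa u := phi u / (lambda * r (u 0 0) ^+ 2).
have lambda0 : lambda != 0.
  by apply: contra_eqN hlambda => /eqP ->; rewrite expr0n eq_sym oner_eq0.
have lr0 u : U u -> lambda * r (u 0 0) ^+ 2 != 0.
  by move=> Uu; rewrite mulf_neq0 ?expf_neq0 ?hr.
have NE u : U u -> N u = kappa u *: P u.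
  move=> Uu; rewrite /kappa -(hnorm _ Uu).
  apply: (@lorentz_complement _ (fun i => pderiv i Gamma u)).
  - exact: hreg.
  - by rewrite hnorm // lr0.
  - by move=> i; exact: hperp.
  - by move=> i; exact: Nperp.
have signE u : U u -> normal_sign N u = phi u ^+ 2 / (lambda * r (u 0 0) ^+ 2).
  move=> Uu; rewrite /normal_sign NE // lorentzZl lorentzZr hnorm // /kappa.
  by field; rewrite lambda0 hr.
have phi_sqr u : U u -> phi u ^+ 2 = r (u 0 0) ^+ 2.
  move=> Uu.
  have : `|phi u ^+ 2 / (lambda * r (u 0 0) ^+ 2)| = 1 by rewrite -signE ?Nunit.
  have lambda1 : `|lambda| = 1.
    by apply/eqP; rewrite -(@eqrXn2 _ 2) // -normrX hlambda expr1n normr1.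
  rewrite normf_div (normrM lambda) lambda1 mul1r !normrX !real_normK ?num_real //.
  by move/divr1_eq.
have sign_lambda u : U u -> normal_sign N u = lambda.
  move=> Uu; rewrite signE // phi_sqr // invfM mulrCA mulfV ?mulr1.
    by apply: (mulfI lambda0); rewrite mulfV // -expr2 hlambda.
  by rewrite expf_neq0 ?hr.
have e0 (k : 'I_3) (h : R) u : k != 0 -> (h *: delta_mx 0 k + u) 0 0 = u 0 0.
  by move=> /negPf k0; rewrite !mxE eqxx eq_sym k0 mulr0 add0r.
(* Along a parameter line of t or w, where s is fixed, phi is continuous with
   values r and - r only. *)
have kappa_line u (k : 'I_3) : U u -> k != 0 ->
    \forall h \near (0 : R), kappa (h *: delta_mx 0 k + u) = kappa u.
  move=> Uu k0.
  pose phih (h : R) := phi (h *: delta_mx 0 k + u).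
  have phih0 : phih 0 = phi u by rewrite /phih scale0r add0r.
  have dP : is_derive u (delta_mx 0 k) P (pderiv k Gamma u).
    apply: (@is_derive_eq_line _ _ _ (Gamma - cst (c (u 0 0)))).
      by near=> h; rewrite /P e0.
    have := is_deriveB (derivableP (hderiv _ k Uu))
                       (is_derive_cst (c (u 0 0)) u (delta_mx 0 k)).
    by rewrite subr0.
  have dN : derivable N u (delta_mx 0 k).
    exact/diff_derivable/(Nsmooth [::] u Uu).
  have dphi : derivable phi u (delta_mx 0 k).
    by have [] := is_derive_lorentz dP (derivableP dN).
  have phi_cvg : phih @ (0 : R) --> phi u.
    rewrite -phih0; apply/differentiable_continuous/derivable1_diffP.
    exact: (derivable1P phi u (delta_mx 0 k)).1 dphi.
  have phi0 : phi u != 0.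
    by rewrite -sqrf_eq0 phi_sqr // sqrf_eq0 hr.
  have : \forall h \near (0 : R), phih h = phi u.
    apply: (near_const_of_sqr phi0 phi_cvg); near=> h.
    have Uh : U (h *: delta_mx 0 k + u) by near: h; exact: near_line.
    by rewrite /phih !phi_sqr // e0.
  by apply: filterS => h hh; rewrite /kappa e0 // -/(phih h) hh.
(* Along these lines N is a constant multiple of Gamma minus a constant. *)
have dN u (k : 'I_3) : U u -> k != 0 ->
    is_derive u (delta_mx 0 k) N (kappa u *: pderiv k Gamma u).
  move=> Uu k0.
  apply: (@is_derive_eq_line _ _ _ (kappa u \*: (Gamma - cst (c (u 0 0))))).
    near=> h.
    have Uh : U (h *: delta_mx 0 k + u) by near: h; exact: near_line.
    have kh : kappa (h *: delta_mx 0 k + u) = kappa u.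
      by near: h; exact: kappa_line.
    by rewrite [RHS]NE // kh /P e0.
  have := is_deriveZ (kappa u) (is_deriveB (derivableP (hderiv _ k Uu))
                     (is_derive_cst (c (u 0 0)) u (delta_mx 0 k))).
  by rewrite subr0.
(* Differentiate <Gamma_i, N> = 0 in the direction k. *)
have hshape u i k : U u -> k != 0 ->
    second_form Gamma N u i k = - kappa u * first_form Gamma u i k.
  move=> Uu k0; rewrite !mxE.
  have [_] := is_derive_lorentz (derivableP (hderiv2 _ i _ Uu k0)) (dN _ _ Uu k0).
  rewrite (@derive_eq_line _ _ _ _ (cst 0)) => [|]; last first.
    near=> h; apply: Nperp; by near: h; exact: near_line.
  rewrite derive_cst lorentzZr => /esym/eqP; rewrite addr_eq0 => /eqP ->.
  by rewrite mulNr.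
have HKE u : U u -> gauss_curvature Gamma N u =
    3 * kappa u ^+ 2 * mean_curvature Gamma N u + 2 * lambda * kappa u ^+ 3.
  move=> Uu; rewrite -(sign_lambda _ Uu); apply: gauss_mean_relation.
  - exact: hreg.
  - by rewrite sign_lambda.
  - by move=> i k; exact: hshape.
move=> u Uu H K.
have a0 : 3 * kappa u ^+ 2 != 0.
  rewrite mulf_neq0 ?pnatr_eq0 // sqrf_eq0 mulf_neq0 ?invr_neq0 ?lr0 //.
  by rewrite -sqrf_eq0 phi_sqr // sqrf_eq0 hr.
have dK (k : 'I_3) : k != 0 -> pderiv k K u = 3 * kappa u ^+ 2 * pderiv k H u.
  move=> k0; rewrite -(derive_affine H (2 * lambda * kappa u ^+ 3) _ _ a0).
  apply: derive_eq_line; near=> h.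
  have Uh : U (h *: delta_mx 0 k + u) by near: h; exact: near_line.
  have kh : kappa (h *: delta_mx 0 k + u) = kappa u.
    by near: h; exact: kappa_line.
  by rewrite /K HKE // kh.
rewrite !dK // mulrCA [X in _ - X]mulrCA [X in _ - _ * X]mulrC.
exact: subrr.
Unshelve. all: by end_near. Qed.

(** * The coefficients of the canal hypersurface *)

Lemma is_derive_cosh (R : realType) (x : R) : is_derive x 1 cosh (sinh x).
Proof.
have h := is_deriveZ 2^-1 (is_deriveD (is_derive_expR x)
  (is_derive1_comp (is_derive_expR (- x)) (is_deriveNid x 1))).
rewrite (_ : cosh = 2^-1 \*: (expR + (expR \o -%R))).
  by apply: (is_derive_eq h); rewrite /sinh /GRing.scale /=; ring.
by apply/funext => y; rewrite /cosh mulrC.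
Qed.

Lemma is_derive_sinh (R : realType) (x : R) : is_derive x 1 sinh (cosh x).
Proof.
have h := is_deriveZ 2^-1 (is_deriveB (is_derive_expR x)
  (is_derive1_comp (is_derive_expR (- x)) (is_deriveNid x 1))).
rewrite (_ : sinh = 2^-1 \*: (expR - (expR \o -%R))).
  by apply: (is_derive_eq h); rewrite /cosh /GRing.scale /=; ring.
by apply/funext => y; rewrite /sinh mulrC.
Qed.

Lemma cosh2_sub_sinh2 (R : realType) (x : R) : cosh x ^+ 2 - sinh x ^+ 2 = 1.
Proof.
transitivity (expR x * expR (- x)); first by rewrite /cosh /sinh; field.
by rewrite -expRD subrr expR0.
Qed.

Definition twice_derivable (R : realType) (f : R -> R) :=
  (forall x, derivable f x 1) /\ (forall x, derivable (derive1 f) x 1).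

Lemma twice_derivableP (R : realType) (f f' f'' : R -> R)
    (hf : forall x, is_derive x (1 : R) f (f' x))
    (hf' : forall x, is_derive x (1 : R) f' (f'' x)) :
  twice_derivable f.
Proof.
split=> x; first exact: ex_derive.
rewrite (_ : derive1 f = f'); first exact: ex_derive.
by apply/funext => y; rewrite derive1E derive_val.
Qed.

Lemma twice_derivable_cst (R : realType) (c : R) : twice_derivable (cst c).
Proof. exact: (@twice_derivableP _ _ (cst 0) (cst 0)). Qed.

Lemma twice_derivable_cos (R : realType) : twice_derivable (@cos R).
Proof. exact: (@twice_derivableP _ _ (- sin) (- cos)). Qed.

Lemma twice_derivable_sin (R : realType) : twice_derivable (@sin R).
Proof. exact: (@twice_derivableP _ _ cos (- sin)). Qed.

Lemma twice_derivable_cosh (R : realType) : twice_derivable (@cosh R).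
Proof. exact: (twice_derivableP (@is_derive_cosh R) (@is_derive_sinh R)). Qed.

Lemma twice_derivable_sinh (R : realType) : twice_derivable (@sinh R).
Proof. exact: (twice_derivableP (@is_derive_sinh R) (@is_derive_cosh R)). Qed.

Lemma canal_coef_split (R : realType) (j i : 'I_4) :
  exists fg : (R -> R) * (R -> R),
    [/\ twice_derivable fg.1, twice_derivable fg.2 &
        forall t w, canal_coef j i t w = fg.1 t * fg.2 w].
Proof.
pose splits (c : R -> R -> R) := exists fg : (R -> R) * (R -> R),
  [/\ twice_derivable fg.1, twice_derivable fg.2 &
      forall t w, c t w = fg.1 t * fg.2 w].
have mul f g : twice_derivable f -> twice_derivable g ->
    splits (fun t w => f t * g w).
  by move=> df dg; exact: (ex_intro _ (f, g) (And3 df dg (fun t w => erefl))).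
have one g : twice_derivable g -> splits (fun _ w => g w).
  move=> dg; have gE (t w : R) : g w = (cst 1 : R -> R) t * g w.
    by rewrite /cst mul1r.
  exists ((cst 1 : R -> R), g).
  exact: (And3 (twice_derivable_cst (1 : R)) dg gE).
have zero : splits (fun _ _ => 0).
  have zE (t w : R) : 0 = (cst 0 : R -> R) t * (cst 0 : R -> R) w.
    by rewrite /cst mul0r.
  exists ((cst 0 : R -> R), (cst 0 : R -> R)).
  exact: (And3 (twice_derivable_cst (0 : R)) (twice_derivable_cst (0 : R)) zE).
have dcos := twice_derivable_cos R; have dsin := twice_derivable_sin R.
have dcosh := twice_derivable_cosh R; have dsinh := twice_derivable_sinh R.
rewrite -/(splits (canal_coef j i)) /canal_coef.
case: j => [[|[|[|[|//]]]] hj] /=; case: i => [[|[|[|[|//]]]] hi] /=.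
- exact: zero.
- exact: (mul _ _ dcos dcos).
- exact: (mul _ _ dsin dcos).
- exact: (one _ dsin).
- exact: zero.
- exact: (mul _ _ dcosh dcosh).
- exact: (one _ dsinh).
- exact: (mul _ _ dsinh dcosh).
- exact: zero.
- exact: (mul _ _ dsinh dcosh).
- exact: (mul _ _ dcosh dcosh).
- exact: (one _ dsinh).
- exact: zero.
- exact: (one _ dsinh).
- exact: (mul _ _ dsinh dcosh).
- exact: (mul _ _ dcosh dcosh).
Qed.

Lemma canal_coef0 (R : realType) (j : 'I_4) (t w : R) : canal_coef j 0 t w = 0.
Proof. by rewrite /canal_coef; case: j => [[|[|[|[|//]]]] hj]. Qed.

(** The coefficients parametrize a piece of a unit pseudo-sphere in the span of
    [F 1, F 2, F 3]: spacelike when [F 0] is timelike, and timelike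
    otherwise. *)
Lemma canal_coef_norm (R : realType) (j : 'I_4) (t w : R) :
  \sum_(i < 4) canal_coef j i t w ^+ 2 * eps j i = - eps j 0.
Proof.
have ht : (cosh t ^+ 2 - sinh t ^+ 2) * cosh w ^+ 2 = cosh w ^+ 2.
  by rewrite cosh2_sub_sinh2 mul1r.
have ct : (cos t ^+ 2 + sin t ^+ 2) * cos w ^+ 2 = cos w ^+ 2.
  by rewrite cos2Dsin2 mul1r.
have hw := cosh2_sub_sinh2 w; have cw := cos2Dsin2 w.
rewrite !big_ord_recl big_ord0 /canal_coef /eps.
by case: j => [[|[|[|[|//]]]] hj] /=; lra.
Qed.

(** * Maps with separated variables *)

(** The shape shared by the canal hypersurface and its first partial
    derivatives. Differentiating in [s] only affects [A] and [B], and
    differentiating in [t] or [w] only affects the scalar factors. *)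
Definition separated_map (R : realType) (A : R -> 'rV[R]_4) (f g : 'I_4 -> R -> R)
    (B : 'I_4 -> R -> 'rV[R]_4) (u : 'rV[R]_3) : 'rV[R]_4 :=
  A (u 0 0) + \sum_(i < 4) (f i (u 0 1) * g i (u 0 2)) *: B i (u 0 0).

Lemma is_derive_separated_map (R : realType) (A : R -> 'rV[R]_4)
    (f g : 'I_4 -> R -> R) (B : 'I_4 -> R -> 'rV[R]_4) (u v : 'rV[R]_3)
    (hA : derivable A (u 0 0) 1)
    (hf : forall i x, derivable (f i) x 1)
    (hg : forall i x, derivable (g i) x 1)
    (hB : forall i, derivable (B i) (u 0 0) 1) :
  is_derive u v (separated_map A f g B)
    (v 0 0 *: separated_map (derive1 A) f g (fun i => derive1 (B i)) u
     + v 0 1 *: separated_map (cst 0) (fun i => derive1 (f i)) g B u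
     + v 0 2 *: separated_map (cst 0) f (fun i => derive1 (g i)) B u).
Proof.
have dA := is_derive_coord_comp v hA.
have dB i := is_derive_coord_comp v (hB i).
have df i := is_derive_coord_comp v (hf i (u 0 1)).
have dg i := is_derive_coord_comp v (hg i (u 0 2)).
have dT i : is_derive u v
    (fun y => (f i (y 0 1) * g i (y 0 2)) *: B i (y 0 0)) _
  := is_derive_scale (is_deriveM (df i) (dg i)) (dB i).
rewrite (_ : separated_map A f g B = (fun y : 'rV[R]_3 => A (y 0 0)) +
    \sum_(i < 4) (fun y : 'rV[R]_3 => (f i (y 0 1) * g i (y 0 2)) *: B i (y 0 0)));
  last by apply/funext => y; rewrite /separated_map !fctE fct_sumE.
apply: (is_derive_eq (is_deriveD dA (is_derive_sum dT))).
rewrite /separated_map /cst !scalerDr !scaler0 !add0r -!addrA; congr (_ + _).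
rewrite !scaler_sumr -!big_split; apply: eq_bigr => i _ /=.
by apply/rowP => k; rewrite !mxE fctE /GRing.scale /=; ring.
Qed.

(** On a line where [s] is constant, [A] and [B] can be replaced by their
    values at [u]. This provides the derivatives along [t] and [w] of the first
    partial derivatives of the canal hypersurface. *)
Lemma derivable_separated_map_line (R : realType) (A : R -> 'rV[R]_4)
    (f g : 'I_4 -> R -> R) (B : 'I_4 -> R -> 'rV[R]_4) (u v : 'rV[R]_3)
    (hv : v 0 0 = 0)
    (hf : forall i x, derivable (f i) x 1)
    (hg : forall i x, derivable (g i) x 1) :
  derivable (separated_map A f g B) u v.
Proof.
pose A0 : R -> 'rV[R]_4 := cst (A (u 0 0)).
pose B0 i : R -> 'rV[R]_4 := cst (B i (u 0 0)).
have h : is_derive u v (separated_map A0 f g B0) _ :=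
  is_derive_separated_map v (derivable_cst _ _ _) hf hg
    (fun i => derivable_cst _ _ _).
have hline : \forall x \near (0 : R),
    separated_map A0 f g B0 (x *: v + u) = separated_map A f g B (x *: v + u).
  by near=> x; rewrite /separated_map !mxE hv mulr0 add0r.
by have [] := is_derive_eq_line hline h.
Unshelve. all: by end_near. Qed.
Arguments derivable_separated_map_line {R} A {f g} B u {v}.

(** * The canal hypersurface *)

Section Radial.
Context {R : realType} (j : 'I_4) (lambda : R) (beta : R -> 'rV[R]_4)
  (F : 'I_4 -> R -> 'rV[R]_4) (r : R -> R).

Lemma canal_radialE (u : 'rV[R]_3) :
  canal j lambda beta F r u - beta (u 0 0) =
  \sum_(i < 4) (if i == 0 then - (lambda * eps j 0 * r (u 0 0) * derive1 r (u 0 0))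
     else r (u 0 0) * Num.sqrt (derive1 r (u 0 0) ^+ 2 - lambda * eps j 0)
          * canal_coef j i (u 0 1) (u 0 2)) *: F i (u 0 0).
Proof.
rewrite /canal /= addrAC (addrC (beta _)) addrK [RHS](bigD1 0) //= scaleNr.
congr (_ + _); rewrite scaler_sumr; apply: eq_bigr => i /negPf ->.
by rewrite scalerA.
Qed.

(** The tangent component [- lambda eps_1 r r'] contributes
    [eps_1 r^2 r'^2], and the other three contribute
    [- eps_1 r^2 (r'^2 - lambda eps_1)]: the terms in [r'] cancel. *)
Lemma canal_radial_norm (u : 'rV[R]_3)
    (hlambda : lambda ^+ 2 = 1)
    (hderiv : lambda * eps j 0 < derive1 r (u 0 0) ^+ 2)
    (hnorm : forall i, lorentz (F i (u 0 0)) (F i (u 0 0)) = eps j i)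
    (horth : forall i l, i != l -> lorentz (F i (u 0 0)) (F l (u 0 0)) = 0) :
  lorentz (canal j lambda beta F r u - beta (u 0 0))
          (canal j lambda beta F r u - beta (u 0 0))
  = lambda * r (u 0 0) ^+ 2.
Proof.
rewrite canal_radialE.
rewrite (lorentz_frame (E := F ^~ (u 0 0)) _ hnorm horth) (bigD1 0) //=.
have := canal_coef_norm j (u 0 1) (u 0 2).
rewrite (bigD1 0) //= canal_coef0 expr0n mul0r add0r => coefE.
under eq_bigr => i /negPf -> do rewrite exprMn -mulrA.
rewrite -big_distrr /= coefE exprMn sqr_sqrtr ?subr_ge0 ?ltW //.
have eps2 : eps j 0 ^+ 2 = 1 :> R.
  by rewrite /eps; case: ifP => _; rewrite ?sqrrN expr1n.
set e := eps j 0 in eps2 *; set s := u 0 0; set r' := derive1 r s.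
transitivity (lambda ^+ 2 * e ^+ 2 * e * r s ^+ 2 * r' ^+ 2
              - e * r s ^+ 2 * r' ^+ 2 + e ^+ 2 * lambda * r s ^+ 2).
  by ring.
by rewrite hlambda eps2; ring.
Qed.

(** This is minus half the derivative of [<P, P> = lambda * r ^+ 2].
    Since [Gamma_s] is [beta' + P_s], the two contributions cancel in
    [<Gamma_s, P>]. *)
Lemma canal_radial_tangent (u : 'rV[R]_3)
    (hnorm : forall i, lorentz (F i (u 0 0)) (F i (u 0 0)) = eps j i)
    (horth : forall i l, i != l -> lorentz (F i (u 0 0)) (F l (u 0 0)) = 0) :
  lorentz (F 0 (u 0 0)) (canal j lambda beta F r u - beta (u 0 0))
  = - (lambda * r (u 0 0) * derive1 r (u 0 0)).
Proof.
rewrite canal_radialE lorentzC.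
rewrite (lorentz_frame_coord (E := F ^~ (u 0 0)) _ 0 hnorm horth) eqxx.
have eps2 : eps j 0 ^+ 2 = 1 :> R.
  by rewrite /eps; case: ifP => _; rewrite ?sqrrN expr1n.
transitivity (- (lambda * r (u 0 0) * derive1 r (u 0 0)) * eps j 0 ^+ 2).
  by ring.
by rewrite eps2 mulr1.
Qed.

End Radial.

Lemma smooth_on_derivable (R : realType) (W : normedModType R) (A : set R)
    (f : R -> W) (s : R) (hf : smooth_on A f) (hs : A s) :
  derivable f s 1 /\ derivable (derive1 f) s 1.
Proof.
split; apply/derivable1_diffP; first exact: (hf [::] s hs).
rewrite (_ : derive1 f = 'D_1 f); first exact: (hf [:: 1] s hs).
by apply/funext => x; rewrite derive1E.
Qed.

Theorem theorem6 (R : realType) (j : 'I_4) (lambda : R) (I : set R)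
  (beta : R -> 'rV[R]_4) (F : 'I_4 -> R -> 'rV[R]_4) (k1 k2 k3 : R -> R)
  (r : R -> R) (U : set 'rV[R]_3) (N : 'rV[R]_3 -> 'rV[R]_4)
  (hlambda : lambda = 1 \/ lambda = -1)
  (hIopen : open I) (hIinterval : is_interval I)
  (hfrenet : frenet_curve j I beta F k1 k2 k3)
  (hrsmooth : smooth_on I r)
  (hrpos : forall s, I s -> 0 < r s)
  (hrderiv : forall s, I s -> lambda * eps j 0 < (derive1 r s) ^+ 2)
  (hUopen : open U)
  (hUdom : forall u, U u -> I (u 0 0))
  (hUreg : forall u, U u ->
     \det (first_form (canal j lambda beta F r) u) != 0)
  (hN : unit_normal_field U (canal j lambda beta F r) N) :
  HK_tw_Weingarten U (canal j lambda beta F r) N.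
Proof.
case: hfrenet => beta_smooth F_smooth _ _ _ tangent Fnorm Forth _ _ _ _.
have lambda2 : lambda ^+ 2 = 1 by case: hlambda => ->; rewrite ?sqrrN expr1n.
have [fg hfg] := choice (canal_coef_split R j).
pose f i := (fg i).1; pose g i := (fg i).2.
have f1 i x : derivable (f i) x 1 by case: (hfg i) => -[].
have f2 i x : derivable (derive1 (f i)) x 1 by case: (hfg i) => -[].
have g1 i x : derivable (g i) x 1 by case: (hfg i) => _ [].
have g2 i x : derivable (derive1 (g i)) x 1 by case: (hfg i) => _ [].
have coefE i t w : canal_coef j i t w = f i t * g i w by case: (hfg i) => _ _ ->.
pose A s := beta s - (lambda * eps j 0 * r s * derive1 r s) *: F 0 s.
pose rho s := r s * Num.sqrt ((derive1 r s) ^+ 2 - lambda * eps j 0).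
pose B i s := rho s *: F i s.
have canalE : canal j lambda beta F r = separated_map A f g B.
  apply/funext => u; rewrite /canal /separated_map; congr (_ + _).
  (* canal_coef vanishes at i = 0, so the sum extends to all four indices. *)
  rewrite [in RHS](bigD1 0) //= -coefE canal_coef0 scale0r add0r scaler_sumr.
  by apply: eq_bigr => i _; rewrite -coefE /B /rho !scalerA mulrC.
have rho_deriv s : I s -> derivable rho s 1.
  move=> Is; have [dr dr'] := smooth_on_derivable hrsmooth Is.
  apply: derivableM => //.
  pose q (x : R) := derive1 r x ^+ 2 - lambda * eps j 0.
  have q_gt0 : 0 < q s by rewrite subr_gt0 hrderiv.
  have dq : is_derive s (1 : R) q _ :=
    is_deriveB (is_deriveX 2 (derivableP dr'))
               (is_derive_cst (lambda * eps j 0) s (1 : R)).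
  by have [] := is_derive1_comp (is_derive1_sqrt q_gt0) dq.
have A_deriv s : I s -> derivable A s 1.
  move=> Is; have [dr dr'] := smooth_on_derivable hrsmooth Is.
  have [dbeta _] := smooth_on_derivable beta_smooth Is.
  have [dF _] := smooth_on_derivable (F_smooth 0) Is.
  have dc : is_derive s (1 : R) (fun s => lambda * eps j 0 * r s * derive1 r s) _ :=
    is_deriveM (is_deriveZ (lambda * eps j 0) (derivableP dr)) (derivableP dr').
  by have [] := is_deriveB (derivableP dbeta) (is_derive_scale dc (derivableP dF)).
have B_deriv i s : I s -> derivable (B i) s 1.
  move=> Is; have [dF _] := smooth_on_derivable (F_smooth i) Is.
  by have [] := is_derive_scale (derivableP (rho_deriv s Is)) (derivableP dF).
pose dGamma (v u : 'rV[R]_3) :=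
  v 0 0 *: separated_map (derive1 A) f g (fun i => derive1 (B i)) u
  + v 0 1 *: separated_map (cst 0) (fun i => derive1 (f i)) g B u
  + v 0 2 *: separated_map (cst 0) f (fun i => derive1 (g i)) B u.
have dcanal u v : U u -> is_derive u v (canal j lambda beta F r) (dGamma v u).
  move=> Uu; have Is := hUdom _ Uu; rewrite canalE.
  exact: (is_derive_separated_map v (A_deriv _ Is) f1 g1 (fun i => B_deriv i _ Is)).
apply: (HK_tw_Weingarten_envelope (c := beta) (r := r) hUopen lambda2) => //.
- by move=> u Uu; rewrite gt_eqF // hrpos //; exact: hUdom.
- move=> u Uu; have Is := hUdom _ Uu.
  by apply: canal_radial_norm => // *; [exact: hrderiv|exact: Fnorm|exact: Forth].
- move=> u i Uu; have Is := hUdom _ Uu.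
  (* Differentiate <P, P> = lambda * r ^+ 2 in the direction i. *)
  pose v : 'rV[R]_3 := delta_mx 0 i.
  pose P y := canal j lambda beta F r y - beta (y 0 0).
  have [dbeta _] := smooth_on_derivable beta_smooth Is.
  have [dr _] := smooth_on_derivable hrsmooth Is.
  have dP : is_derive u v P (pderiv i (canal j lambda beta F r) u
                             - v 0 0 *: derive1 beta (u 0 0)).
    have dG : derivable (canal j lambda beta F r) u v by have [] := dcanal u v Uu.
    exact: is_deriveB (derivableP dG) (is_derive_coord_comp v dbeta).
  have dr0 := is_derive_coord_comp v dr.
  have [_ normE] := is_deriveZ lambda (is_deriveM dr0 dr0).
  have [_] := is_derive_lorentz dP dP.
  rewrite (@derive_eq_line _ _ _ _
    (lambda \*: ((fun y : 'rV[R]_3 => r (y 0 0)) * (fun y => r (y 0 0)))));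
    last first.
    near=> h.
    have Uh : U (h *: v + u) by near: h; exact: near_line.
    have Ih := hUdom _ Uh.
    rewrite canal_radial_norm ?expr2 // => [|l|l m lm].
    - exact: hrderiv.
    - exact: Fnorm.
    - exact: Forth.
  rewrite normE (lorentzC _ (P u)) => e; rewrite -/(P u) (lorentzC _ (P u)).
  have tangentE : lorentz (P u) (derive1 beta (u 0 0)) =
      - (lambda * r (u 0 0) * derive1 r (u 0 0)).
    rewrite -tangent // lorentzC.
    by apply: canal_radial_tangent => *; [exact: Fnorm|exact: Forth].
  move: e; rewrite !lorentzBr lorentzZr tangentE /GRing.scale /= => e; lra.
- by move=> u k Uu; have [] := dcanal u (delta_mx 0 k) Uu.
- move=> u i k Uu k0.
  have ek0 : (delta_mx 0 k : 'rV[R]_3) 0 0 = 0.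
    by rewrite mxE eqxx eq_sym (negPf k0).
  have pcanal : \forall h \near (0 : R),
      dGamma (delta_mx 0 i) (h *: delta_mx 0 k + u) =
      pderiv i (canal j lambda beta F r) (h *: delta_mx 0 k + u).
    near=> h.
    have Uh : U (h *: delta_mx 0 k + u) by near: h; exact: near_line.
    by have [_ <-] := dcanal _ (delta_mx 0 i) Uh.
  have ds := derivableP (derivable_separated_map_line (derive1 A)
    (fun i => derive1 (B i)) u ek0 f1 g1).
  have dt := derivableP (derivable_separated_map_line (cst 0) B u ek0 f2 g1).
  have dw := derivableP (derivable_separated_map_line (cst 0) B u ek0 f1 g2).
  have dd : is_derive u (delta_mx 0 k) (dGamma (delta_mx 0 i)) _ :=
    is_deriveD (is_deriveD (is_deriveZ _ ds) (is_deriveZ _ dt)) (is_deriveZ _ dw).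
  by have [] := is_derive_eq_line pcanal dd.
Unshelve. all: by end_near. Qed.
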